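(* Let $x$ and $y$ be nonzero integers. Then the real number $e^{x/y}$ is irrational. *)

(* Defs.v *)
From mathcomp Require Export all_boot all_order all_algebra.
From mathcomp Require Export all_classical all_reals all_analysis.

Set Implicit Arguments.
Unset Strict Implicit.
Unset Printing Implicit Defensive.

(* Main.v *)
(** Niven's method, with the mean value theorem in place of integrals.  Taking
    absolute values and an integral power, it is enough to treat [e^m] with
    [m > 0] an integer.  For a polynomial [f] let
    [F = f - f' + f'' - ...], so that [(e^t F(t))' = e^t f(t)].
    With [f = X^n (X - m)^n / n!] the numbers [F(0)] and [F(m)] are integers.
    If [e^m = a / b], the integer [b (e^m F(m) - F(0)) = b m e^c f(c)], with
    [0 < c < m], is nonzero and bounded by [b m e^m (m^2)^n / n!], which tends
    to [0] with [n]. *)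
Require Import Defs.
Import Order.TTheory GRing.Theory Num.Theory.
Import numFieldNormedType.Exports.

Local Open Scope ring_scope.

(** Each derivative removes only one factor ['X - a%:P]. The cofactor changes with it, so the
    induction is over all [q]. *)
Lemma derivn_horner_XsubC_exp {R : comNzRingType} {a : R} {q : {poly R}} {n k} :
  (k < n)%N -> (('X - a%:P) ^+ n * q)^`(k).[a] = 0.
Proof.
elim: k n q => [|k IHk] [|n] // q ltkn.
  by rewrite derivn0 hornerM horner_exp hornerXsubC subrr expr0n mul0r.
have deriv_prod : (('X - a%:P) ^+ n.+1 * q)^`() =
    ('X - a%:P) ^+ n * (q *+ n.+1 + ('X - a%:P) * q^`()).
  by rewrite derivM deriv_exp derivXsubC mul1r mulrDr mulrnAl -mulrnAr mulrA -exprSr.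
by rewrite derivSn deriv_prod IHk.
Qed.

(** Below order [n] the root at [a] gives zero. From order [n] on, the [k]-th derivative is [k!]
    times [nderivn], which keeps coefficients integral, and [n!] divides [k!]. *)
Lemma derivn_horner_int {R : archiRealFieldType} {a : R} {q : {poly R}} {n k} :
  a \is a Num.int -> q \is a polyOver Num.int ->
  (n`!%:R^-1 *: (('X - a%:P) ^+ n * q))^`(k).[a] \is a Num.int.
Proof.
move=> a_int q_int; rewrite derivnZ hornerZ.
have [ltkn|lenk] := ltnP k n.
  by rewrite derivn_horner_XsubC_exp// mulr0 rpred0.
rewrite nderivn_def hornerMn -(bin_fact lenk) mulnCA mulrnA mulrnAr.
rewrite -[_.[_] *+ _]mulr_natl mulKf ?pnatr_eq0 -?lt0n ?fact_gt0//.
rewrite rpredMn// rpred_horner// polyOver_nderivn// rpredM// rpredX//.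
by rewrite polyOverXsubC.
Qed.

(** Derivatives of order [size p] and above vanish, so this is the full alternating series. *)
Definition alt_derivn_sum {R : nzRingType} (p : {poly R}) : {poly R} :=
  \sum_(i < size p) (-1) ^+ i *: p^`(i).

Lemma alt_derivn_sumP {R : comNzRingType} (p : {poly R}) :
  (alt_derivn_sum p)^`() + alt_derivn_sum p = p.
Proof.
rewrite /alt_derivn_sum linear_sum -big_split /=.
rewrite -(big_mkord xpredT (fun i => ((-1) ^+ i *: p^`(i))^`() + (-1) ^+ i *: p^`(i))).
(* The sum telescopes: each term is [u (i+1) - u i] for [u i = - (-1)^i p^(i)], with
   [u (size p) = 0] and [- u 0 = p]. *)
rewrite (eq_bigr (fun i => (- (-1) ^+ i.+1 *: p^`(i.+1)) - (- (-1) ^+ i *: p^`(i)))).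
  rewrite (telescope_sumr (fun i => - (-1) ^+ i *: p^`(i)))//.
  by rewrite derivn_poly0// scaler0 sub0r expr0 scaleN1r opprK derivn0.
by move=> i _; rewrite derivZ -derivnS exprS mulN1r opprK scaleNr opprK.
Qed.

Lemma alt_derivn_sum_horner_int {R : archiRealFieldType} {p : {poly R}} {a : R} :
  (forall k, p^`(k).[a] \is a Num.int) -> (alt_derivn_sum p).[a] \is a Num.int.
Proof.
move=> p_int; rewrite horner_sum rpred_sum// => i _.
by rewrite hornerZ rpredM// rpredX// rpredN rpred1.
Qed.

Lemma polyOver_XsubC_exp {R : nzRingType} (S : subringClosed R) {a : R} n :
  a \in S -> ('X - a%:P) ^+ n \is a polyOver S.
Proof. by move=> Sa; rewrite rpredX// polyOverXsubC. Qed.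

Definition niven_poly (R : fieldType) (m n : nat) : {poly R} :=
  n`!%:R^-1 *: ('X ^+ n * ('X - m%:R%:P) ^+ n).

Lemma niven_poly_derivn0_int {R : archiRealFieldType} (m n k : nat) :
  (niven_poly R m n)^`(k).[0] \is a Num.int.
Proof.
rewrite /niven_poly -[X in X ^+ n * _]subr0 -polyC0.
apply: derivn_horner_int; first exact: rpred0.
exact/polyOver_XsubC_exp/natr_int.
Qed.

Lemma niven_poly_derivn_natr_int {R : archiRealFieldType} (m n k : nat) :
  (niven_poly R m n)^`(k).[m%:R] \is a Num.int.
Proof.
rewrite /niven_poly mulrC -[X in _ * X ^+ n]subr0 -polyC0.
apply: derivn_horner_int; first exact: natr_int.
exact/polyOver_XsubC_exp/rpred0.
Qed.

Lemma expR_mul_alt_derivn_sum_MVT {R : realType} (p : {poly R}) {a b : R} :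
  a < b -> exists2 c : R, a < c < b &
    expR b * (alt_derivn_sum p).[b] - expR a * (alt_derivn_sum p).[a] =
    expR c * p.[c] * (b - a).
Proof.
move=> ltab; pose g (t : R) := expR t * (alt_derivn_sum p).[t].
have g_drv (t : R) : is_derive t 1 g (expR t * p.[t]).
  rewrite -[in p.[t]](alt_derivn_sumP p).
  have := is_deriveM (is_derive_expR t) (is_derive_poly (alt_derivn_sum p) t).
  move/is_derive_eq; apply; rewrite hornerD mulrDr; congr (_ + _).
  exact: mulrC.
have [|c cab eqg] := MVT ltab (fun t _ => g_drv t).
  apply: continuous_subspaceT => t; apply: differentiable_continuous.
  exact/derivable1_diffP/ex_derive.
by exists c; rewrite ?in_itv in cab *.
Qed.

Lemma expR_natr_irrational {R : realType} {m : nat} :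
  (0 < m)%N -> irrational (expR m%:R : R).
Proof.
move=> m_gt0 /rationalP[a [b expRE]].
have m0 : 0 < m%:R :> R by rewrite ltr0n.
have b_gt0 : (0 < b)%N.
  (* Since [0^-1 = 0], a zero denominator would give [expR m = 0]. *)
  rewrite lt0n; apply/eqP => b0; have := expR_gt0 (m%:R : R).
  by rewrite expRE b0 invr0 mulr0 ltxx.
have b0 : b%:R != 0 :> R by rewrite pnatr_eq0 -lt0n.
(* [C] is free of [n] and of [c], so [n] can be fixed before the mean value theorem yields a [c]
   depending on it. *)
pose C : R := b%:R * expR m%:R * m%:R.
have C_gt0 : 0 < C by rewrite !mulr_gt0 ?expR_gt0 ?ltr0n.
have [n ltn1] : exists n, C * ((m%:R ^+ 2) ^+ n / n`!%:R) < 1.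
  have /cvgr0_norm_lt/(_ C^-1) := @pi_irrational.exp_fact R (m%:R ^+ 2).
  rewrite invr_gt0 => /(_ C_gt0)[N _ /(_ N (leqnn N))] ltN.
  by exists N; rewrite mulrC -ltr_pdivlMr// div1r (le_lt_trans _ ltN)// ler_norm.
pose f : {poly R} := niven_poly R m n.
have n_fact_gt0 : 0 < n`!%:R :> R by rewrite ltr0n fact_gt0.
have F0_int : (alt_derivn_sum f).[0] \is a Num.int.
  exact/alt_derivn_sum_horner_int/niven_poly_derivn0_int.
have Fm_int : (alt_derivn_sum f).[m%:R] \is a Num.int.
  exact/alt_derivn_sum_horner_int/niven_poly_derivn_natr_int.
have [c /andP[c0 cm]] := expR_mul_alt_derivn_sum_MVT f m0.
rewrite expR0 mul1r subr0 => eqF.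
have fcE : f.[c] = (c * (c - m%:R)) ^+ n / n`!%:R.
  rewrite /f /niven_poly hornerZ hornerM !horner_exp.
  by rewrite hornerX hornerXsubC -exprMn mulrC.
have cm_lt0 : c - m%:R < 0 by rewrite subr_lt0.
pose z := b%:R * (expR c * f.[c] * m%:R).
have z_int : z \is a Num.int.
  (* Here [z = b (e^m F(m) - F(0)) = a F(m) - b F(0)]. *)
  rewrite /z -eqF expRE mulrBr mulrA mulrCA divff// mulr1.
  by rewrite rpredB// rpredM// ?natr_int// intr_int.
have z_neq0 : z != 0.
  have cm_neq0 : c * (c - m%:R) != 0.
    by rewrite mulf_neq0 ?(gt_eqF c0) ?(lt_eqF cm_lt0).
  by rewrite /z fcE !mulf_neq0 ?invr_eq0 ?expf_neq0 ?(gt_eqF m0)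
    ?(gt_eqF n_fact_gt0) ?(gt_eqF (expR_gt0 c)).
have := norm_intr_ge1 z_int z_neq0; rewrite leNgt => /negP; apply.
apply: le_lt_trans ltn1; rewrite /z fcE !normrM normfV normrX normrM.
rewrite !normr_nat gtr0_norm ?expR_gt0// (gtr0_norm c0) (ltr0_norm cm_lt0) opprB.
(* Grouped this way, the two factors are compared separately with [C] and [(m^2)^n / n!]. *)
rewrite [leLHS](_ : _ =
  b%:R * expR c * m%:R * ((c * (m%:R - c)) ^+ n / n`!%:R)); last first.
  by rewrite [X in _ * X = _]mulrAC !mulrA.
have mc_ge0 : 0 <= m%:R - c by rewrite subr_ge0 ltW.
have cmc_ge0 : 0 <= c * (m%:R - c) by rewrite mulr_ge0 ?(ltW c0).
apply: ler_pM.
- by rewrite !mulr_ge0 ?expR_ge0.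
- by rewrite mulr_ge0 ?invr_ge0// exprn_ge0.
- by rewrite ler_pM2r// ler_pM2l ?ltr0n// ler_expR ltW.
have cmc_le : c * (m%:R - c) <= m%:R ^+ 2.
  by rewrite expr2 ler_pM// ?(ltW c0) ?(ltW cm)// lerBlDr lerDl ltW.
by rewrite ler_pM2r ?invr_gt0// lerXn2r// nnegrE (le_trans cmc_ge0).
Qed.

Theorem mainTheorem1 (R : realType) (x y : int) (x_neq0 : x <> 0) (y_neq0 : y <> 0) :
  irrational (expR (x%:~R / y%:~R) : R).
Proof.
set t : R := x%:~R / y%:~R => -[q _ qE].
(* Rationals are closed under inverse and [e^(-t) = 1 / e^t], so the sign of [t] is harmless. *)
have [r rE] : exists r : rat, ratr r = expR `|t|.
  have [t_ge0|t_lt0] := ger0P t; first by exists q.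
  by exists q^-1; rewrite expRN fmorphV /= qE.
have x_gt0 : (0 < `|x|)%N by rewrite absz_gt0; apply/eqP.
apply: (expR_natr_irrational (R := R) x_gt0).
(* Raising to the power [|y|] clears the denominator: [|t| |y| = |x|]. *)
exists (r ^+ `|y|%N) => //; rewrite rmorphXn /= rE -expRM_natr.
congr expR; rewrite normf_div !natr_absz -!intr_norm divfK//.
by rewrite intr_eq0 normr_eq0; apply/eqP.
Qed.
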